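(* A quaternionic Kähler NH-manifold $(M,H,G)$ is Ricci-flat ($\rho=0$) if and only if it is flat ($R=0$).
   Context: $M$ is a smooth manifold of dimension $4n$. An almost hypercomplex structure on $M$ is a triple $H=(J_1,J_2,J_3)$ of almost complex structures with $J_\alpha=J_\beta\circ J_\gamma=-J_\gamma\circ J_\beta$ and $J_\alpha^2=-I$ for all cyclic permutations $(\alpha,\beta,\gamma)$ of $(1,2,3)$. Put $\varepsilon_1=1$, $\varepsilon_2=\varepsilon_3=-1$. An NH-metric structure $G=(g,g_1,g_2,g_3)$ on $(M,H)$ consists of a pseudo-Riemannian metric $g$ of neutral signature $(2n,2n)$ with $g(x,y)=\varepsilon_\alpha g(J_\alpha x,J_\alpha y)$ for $\alpha=1,2,3$, together with $g_\alpha(x,y)=g(J_\alpha x,y)=-\varepsilon_\alpha g(x,J_\alpha y)$. $(M,H,G)$ is then an almost hypercomplex NH-manifold. Let $\nabla$ be the Levi-Civita connection of $g$. $(M,H,G)$ is a quaternionic Kähler NH-manifold if there are (local) 1-forms $\omega_1,\omega_2,\omega_3$ with $(\nabla_xJ_\alpha)y=\omega_\gamma(x)J_\beta y-\omega_\beta(x)J_\gamma y$ for all cyclic permutations $(\alpha,\beta,\gamma)$ of $(1,2,3)$. $R$ is the curvature tensor of $\nabla$: $R(x,y)z=[\nabla_x,\nabla_y]z-\nabla_{[x,y]}z$, $R(x,y,z,w)=g(R(x,y)z,w)$; the Ricci tensor is $\rho(y,z)=g^{ij}R(e_i,y,z,e_j)$. *)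

(* Defs.v *)
From HB Require Import structures.
From mathcomp Require Import all_boot all_order all_algebra.
From mathcomp Require Import all_classical all_reals all_analysis.
Import Order.TTheory GRing.Theory Num.Theory numFieldNormedType.Exports.

Set Implicit Arguments.
Unset Strict Implicit.
Unset Printing Implicit Defensive.

Local Open Scope classical_set_scope.
Local Open Scope ring_scope.

(* Vectors of the model space R^d are columns, so that a matrix A acts as an
   endomorphism by A *m v and composition is the matrix product.  Tensor fields
   on a manifold are families, indexed by the charts of an atlas, of smooth
   component functions on the coordinate domains, which correspond to each
   other under the differentials of the transition maps. *)

Fixpoint Ck {R : realType} {V W : normedModType R} (k : nat)
    (U : set V) (f : V -> W) : Prop :=
  match k with
  | 0 => forall x, U x -> {for x, continuous f}
  | k'.+1 => (forall x, U x -> differentiable f x) /\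
             (forall v, Ck k' U (fun x => 'D_v f x))
  end.

Definition smooth_on {R : realType} {V W : normedModType R}
    (U : set V) (f : V -> W) : Prop := forall k, Ck k U f.

(* [cinv] is meaningful on [cmap @` cdom] only. *)
Record chart (R : realType) (d : nat) (M : topologicalType) := Chart {
  cdom : set M;
  cmap : M -> 'cV[R]_d;
  cinv : 'cV[R]_d -> M;
  cdom_open : open cdom;
  cimg_open : open (cmap @` cdom);
  cmapK : forall p, cdom p -> cinv (cmap p) = p;
  cmap_continuous : {within cdom, continuous cmap};
  cinv_continuous : {within cmap @` cdom, continuous cinv} }.

(* The part of the set [W] covered by [c], seen in the coordinates of [c]. *)
Definition in_coord {R : realType} {d : nat} {M : topologicalType}
    (c : chart R d M) (W : set M) : set 'cV[R]_d :=
  cmap c @` (cdom c `&` W).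

Definition transition {R : realType} {d : nat} {M : topologicalType}
    (c c' : chart R d M) (x : 'cV[R]_d) : 'cV[R]_d := cmap c' (cinv c x).

Record smoothManifold (R : realType) (d : nat) := SmoothManifold {
  carrier :> topologicalType;
  manifold_hausdorff : hausdorff_space carrier;
  manifold_second_countable : @second_countable carrier;
  atlas_index : Type;
  atlas : atlas_index -> chart R d carrier;
  atlas_cover : forall p : carrier, exists i, cdom (atlas i) p;
  atlas_smooth : forall i j,
    smooth_on (in_coord (atlas i) (cdom (atlas j)))
              (transition (atlas i) (atlas j)) }.

Definition coord {R : realType} {d : nat} (M : smoothManifold R d)
    (i : atlas_index M) : set 'cV[R]_d := in_coord (atlas i) setT.

Definition overlap {R : realType} {d : nat} (M : smoothManifold R d)
    (i j : atlas_index M) : set 'cV[R]_d :=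
  in_coord (atlas i) (cdom (atlas j)).

Definition trans {R : realType} {d : nat} (M : smoothManifold R d)
    (i j : atlas_index M) : 'cV[R]_d -> 'cV[R]_d :=
  transition (atlas i) (atlas j).

Definition bil {R : realType} {d : nat} (G : 'M[R]_d) (u v : 'cV[R]_d) : R :=
  (u^T *m G *m v) 0 0.

Definition covec {R : realType} {d : nat} (w : 'rV[R]_d) (v : 'cV[R]_d) : R :=
  (w *m v) 0 0.

Record endo_field {R : realType} {d : nat} (M : smoothManifold R d) :=
  EndoField {
  endo :> atlas_index M -> 'cV[R]_d -> 'M[R]_d;
  endo_smooth : forall i, smooth_on (coord i) (endo i);
  endo_change : forall i j x, overlap i j x -> forall v : 'cV[R]_d,
    endo j (trans i j x) *m 'D_v (trans i j) x
    = 'D_(endo i x *m v) (trans i j) x }.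

Record bilinear_field {R : realType} {d : nat} (M : smoothManifold R d) :=
  BilinearField {
  bform :> atlas_index M -> 'cV[R]_d -> 'M[R]_d;
  bform_smooth : forall i, smooth_on (coord i) (bform i);
  bform_change : forall i j x, overlap i j x -> forall u v : 'cV[R]_d,
    bil (bform j (trans i j x)) ('D_u (trans i j) x) ('D_v (trans i j) x)
    = bil (bform i x) u v }.

Record one_form_on {R : realType} {d : nat} (M : smoothManifold R d)
    (W : set M) := OneFormOn {
  oform :> atlas_index M -> 'cV[R]_d -> 'rV[R]_d;
  oform_smooth : forall i, smooth_on (in_coord (atlas i) W) (oform i);
  oform_change : forall i j x,
    in_coord (atlas i) (W `&` cdom (atlas j)) x -> forall v : 'cV[R]_d,
    covec (oform j (trans i j x)) ('D_v (trans i j) x)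
    = covec (oform i x) v }.

Definition lie_bracket {R : realType} {d : nat}
    (X Y : 'cV[R]_d -> 'cV[R]_d) (x : 'cV[R]_d) : 'cV[R]_d :=
  'D_(X x) Y x - 'D_(Y x) X x.

(* The covariant derivative of Y along X for the connection matrices
   A_k = (Gamma^l_{k m})_{l, m}. *)
Definition coord_cov {R : realType} {d : nat}
    (A : 'cV[R]_d -> 'I_d -> 'M[R]_d) (X Y : 'cV[R]_d -> 'cV[R]_d)
    (x : 'cV[R]_d) : 'cV[R]_d :=
  'D_(X x) Y x + \sum_(k < d) X x k 0 *: (A x k *m Y x).

(* The inhomogeneous transformation law of the Christoffel symbols is stated as
   the independence of the covariant derivative from the chart: the fields X, Y
   and X', Y' below are the expressions of the same two vector fields in the
   charts i and j. *)
Record affine_connection {R : realType} {d : nat} (M : smoothManifold R d) :=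
  AffineConnection {
  christoffel : atlas_index M -> 'cV[R]_d -> 'I_d -> 'M[R]_d;
  christoffel_smooth : forall i k,
    smooth_on (coord i) (fun x => christoffel i x k);
  christoffel_change : forall i j (X Y X' Y' : 'cV[R]_d -> 'cV[R]_d),
    smooth_on (overlap i j) X -> smooth_on (overlap i j) Y ->
    smooth_on (overlap j i) X' -> smooth_on (overlap j i) Y' ->
    (forall x, overlap i j x ->
       X' (trans i j x) = 'D_(X x) (trans i j) x) ->
    (forall x, overlap i j x ->
       Y' (trans i j x) = 'D_(Y x) (trans i j) x) ->
    forall x, overlap i j x ->
      coord_cov (christoffel j) X' Y' (trans i j x)
      = 'D_(coord_cov (christoffel i) X Y x) (trans i j) x }.

Definition cov {R : realType} {d : nat} (M : smoothManifold R d)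
    (nabla : affine_connection M) (i : atlas_index M)
    (X Y : 'cV[R]_d -> 'cV[R]_d) : 'cV[R]_d -> 'cV[R]_d :=
  coord_cov (christoffel nabla i) X Y.

Definition cov_endo {R : realType} {d : nat} (M : smoothManifold R d)
    (nabla : affine_connection M) (J : endo_field M) (i : atlas_index M)
    (X Y : 'cV[R]_d -> 'cV[R]_d) (x : 'cV[R]_d) : 'cV[R]_d :=
  cov nabla i X (fun y => J i y *m Y y) x - J i x *m cov nabla i X Y x.

Definition levi_civita {R : realType} {d : nat} (M : smoothManifold R d)
    (g : bilinear_field M) (nabla : affine_connection M) : Prop :=
  (forall i (X Y : 'cV[R]_d -> 'cV[R]_d),
     smooth_on (coord i) X -> smooth_on (coord i) Y ->
     forall x, coord i x ->
       cov nabla i X Y x - cov nabla i Y X x = lie_bracket X Y x) /\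
  (forall i (X Y Z : 'cV[R]_d -> 'cV[R]_d),
     smooth_on (coord i) X -> smooth_on (coord i) Y ->
     smooth_on (coord i) Z ->
     forall x, coord i x ->
       'D_(X x) (fun y => bil (g i y) (Y y) (Z y)) x
       = bil (g i x) (cov nabla i X Y x) (Z x)
         + bil (g i x) (Y x) (cov nabla i X Z x)).

Definition curvature {R : realType} {d : nat} (M : smoothManifold R d)
    (nabla : affine_connection M) (i : atlas_index M)
    (X Y Z : 'cV[R]_d -> 'cV[R]_d) (x : 'cV[R]_d) : 'cV[R]_d :=
  cov nabla i X (cov nabla i Y Z) x - cov nabla i Y (cov nabla i X Z) x
  - cov nabla i (lie_bracket X Y) Z x.

Definition curvature4 {R : realType} {d : nat} (M : smoothManifold R d)
    (g : bilinear_field M) (nabla : affine_connection M) (i : atlas_index M)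
    (X Y Z W : 'cV[R]_d -> 'cV[R]_d) (x : 'cV[R]_d) : R :=
  bil (g i x) (curvature nabla i X Y Z x) (W x).

(* The Ricci trace g^{ab} R(e_a, Y, Z, e_b) uses the coordinate frame. *)
Definition coord_field {R : realType} {d : nat} (a : 'I_d) :
    'cV[R]_d -> 'cV[R]_d := fun=> delta_mx a 0.

Definition ricci {R : realType} {d : nat} (M : smoothManifold R d)
    (g : bilinear_field M) (nabla : affine_connection M) (i : atlas_index M)
    (Y Z : 'cV[R]_d -> 'cV[R]_d) (x : 'cV[R]_d) : R :=
  \sum_(a < d) \sum_(b < d) invmx (g i x) a b
    * curvature4 g nabla i (coord_field a) Y Z (coord_field b) x.

Definition flat {R : realType} {d : nat} (M : smoothManifold R d)
    (nabla : affine_connection M) : Prop :=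
  forall i (X Y Z : 'cV[R]_d -> 'cV[R]_d),
    smooth_on (coord i) X -> smooth_on (coord i) Y ->
    smooth_on (coord i) Z ->
    forall x, coord i x -> curvature nabla i X Y Z x = 0.

Definition ricci_flat {R : realType} {d : nat} (M : smoothManifold R d)
    (g : bilinear_field M) (nabla : affine_connection M) : Prop :=
  forall i (Y Z : 'cV[R]_d -> 'cV[R]_d),
    smooth_on (coord i) Y -> smooth_on (coord i) Z ->
    forall x, coord i x -> ricci g nabla i Y Z x = 0.

(* The indices 1, 2, 3 are the elements 0, 1, 2 of 'I_3; the cyclic
   permutations of (1,2,3) are the triples (a, ordS a, ordS (ordS a)). *)
Record almost_hypercomplex {R : realType} {d : nat} (M : smoothManifold R d) :=
  AlmostHypercomplex {
  ahJ :> 'I_3 -> endo_field M;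
  ahJ_mul : forall a i x, coord i x ->
    ahJ a i x = ahJ (ordS a) i x *m ahJ (ordS (ordS a)) i x;
  ahJ_anti : forall a i x, coord i x ->
    ahJ a i x = - (ahJ (ordS (ordS a)) i x *m ahJ (ordS a) i x);
  ahJ_sqr : forall a i x, coord i x ->
    ahJ a i x *m ahJ a i x = - 1%:M }.

Definition eps {R : realType} (a : 'I_3) : R := if a == ord0 then 1 else -1.

(* [G] admits a basis with respect to which it is diag(1,..,1,-1,..,-1), with
   p entries 1. *)
Definition signature {R : realType} {d : nat} (p : nat) (G : 'M[R]_d) : Prop :=
  exists2 P : 'M[R]_d, P \in unitmx
    & P^T *m G *m P = diag_mx (\row_(k < d) (if (k < p)%N then 1 else -1)).

Record NH_metric {R : realType} {n : nat} (M : smoothManifold R (4 * n))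
    (H : almost_hypercomplex M) := NHMetric {
  nh_g :> bilinear_field M;
  nh_ga : 'I_3 -> bilinear_field M;
  nh_sym : forall i x, coord i x -> forall u v : 'cV[R]_(4 * n),
    bil (nh_g i x) u v = bil (nh_g i x) v u;
  nh_neutral : forall i x, coord i x -> signature (2 * n) (nh_g i x);
  nh_compat : forall a i x, coord i x -> forall u v : 'cV[R]_(4 * n),
    bil (nh_g i x) u v
    = eps a * bil (nh_g i x) (H a i x *m u) (H a i x *m v);
  nh_gaE : forall a i x, coord i x -> forall u v : 'cV[R]_(4 * n),
    bil (nh_ga a i x) u v = bil (nh_g i x) (H a i x *m u) v;
  nh_gaE' : forall a i x, coord i x -> forall u v : 'cV[R]_(4 * n),
    bil (nh_ga a i x) u v = - eps a * bil (nh_g i x) u (H a i x *m v) }.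

Definition quaternionic_kahler {R : realType} {d : nat}
    (M : smoothManifold R d) (H : almost_hypercomplex M)
    (nabla : affine_connection M) : Prop :=
  forall p : M, exists W : set M, [/\ open W, W p &
    exists omega : 'I_3 -> one_form_on W,
      forall a i (X Y : 'cV[R]_d -> 'cV[R]_d),
        smooth_on (in_coord (atlas i) W) X ->
        smooth_on (in_coord (atlas i) W) Y ->
        forall x, in_coord (atlas i) W x ->
          let b := ordS a in let c := ordS b in
          cov_endo nabla (H a) i X Y x
          = covec (omega c i x) (X x) *: (H b i x *m Y x)
            - covec (omega b i x) (X x) *: (H c i x *m Y x)].

(* Main.v *)
From HB Require Import structures.
From mathcomp Require Import all_boot all_order all_algebra.
From mathcomp Require Import all_classical all_reals all_analysis.
From mathcomp Require Import ring lra.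
Require Import Defs.
Import Order.TTheory GRing.Theory Num.Theory numFieldNormedType.Exports.

(** Write A for the connection matrices of the Levi-Civita connection in a chart
    and F(u,v) for its curvature endomorphisms.  Flatness trivially implies
    Ricci-flatness; the converse rests on the mixed behaviour of the three
    structures towards g: J1 is an isometry, hence g-skew, while J2 and J3 are
    anti-isometries, hence g-symmetric.

    Since g is parallel, nabla J is g-skew or g-symmetric together with J.  But
    nabla J1 is a combination of J2 and J3, which are symmetric, so nabla J1 = 0;
    and the J1-components of nabla J2 and nabla J3 are skew, so they vanish and
    nabla_w J2 = omega_1(w) J3, nabla_w J3 = - omega_1(w) J2 ([nabla_J1],
    [nabla_J2], [nabla_J3]).  Differentiating once more and using the symmetry of
    second derivatives (the Ricci identity [ricci_identity], fed by [schwarz_mx])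
    gives [F,J1] = 0 and [F,J2] = (d omega_1) J3 ([curv_commute],
    [curv_commutator]).

    So (g, J1) is pseudo-Kaehler, and the Bianchi identity expresses
    tr(F(u,v) J1) through the Ricci tensor ([ricci_form_trace]).  On the other
    hand, tracing [F,J2] = (d omega_1) J3 against J3 shows that
    tr(F(u,v) J1) = - 2n d omega_1(u,v) ([traceless_commutator]).  Ricci-flatness
    therefore forces (d omega_1) J3 = 0, and F commutes with all three structures.

    Such an F vanishes ([hyperkahler_NH_flat]).  For a g-symmetric J commuting
    with F, the tensor R(x,y,z,w) = g(F(x,y)z,w) lets J travel from any slot to
    any other ([curvature_transfer]).  When J2 and J3 are carried to the third slot
    along different routes, they arrive there composed in either order, that is, as
    J1 or as - J1; so R(x,y,J1 z,w) equals its opposite.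

    The reduction to endomorphisms F(u,v) at a point is [curvatureE]: the
    curvature of arbitrary vector fields, defined by iterated covariant
    derivatives, is tensorial. *)

Set Implicit Arguments.
Unset Strict Implicit.
Unset Printing Implicit Defensive.

Local Open Scope classical_set_scope.
Local Open Scope ring_scope.

(** * Curvature tensors and quaternionic algebra *)

Section MatrixEntries.
Context {R : pzRingType} {m n : nat}.
Implicit Types (A B : 'M[R]_(m, n)).

Lemma addmxE A B i j : (A + B) i j = A i j + B i j. Proof. by rewrite mxE. Qed.

Lemma oppmxE A i j : (- A) i j = - A i j. Proof. by rewrite mxE. Qed.

Lemma scalemxE a A i j : (a *: A) i j = a * A i j. Proof. by rewrite mxE. Qed.

End MatrixEntries.

Section CurvatureTensors.
Context {K : realFieldType} {T : Type} (r : T -> T -> T -> T -> K).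
Hypothesis skew12 : forall u v z w, r u v z w = - r v u z w.
Hypothesis skew34 : forall u v z w, r u v z w = - r u v w z.
Hypothesis bianchi : forall u v z w, r u v z w + r v z u w + r z u v w = 0.

(** In the sum of the four Bianchi identities obtained by rotating the arguments,
    the skew-symmetries cancel eight terms and identify the other four in
    pairs. *)
Lemma curvature_pair_symmetry u v z w : r u v z w = r z w u v.
Proof.
have := bianchi v z u w; have := bianchi z u w v.
have := bianchi u w v z; have := bianchi w v z u.
have := skew34 v z u w; have := skew34 z u v w.
have := skew34 u w z v; have := skew34 w v u z.
have := skew12 u v z w; have := skew34 v u z w.
have := skew12 z w u v; have := skew34 z w u v.
by lra.
Qed.

(** A J that moves between the last two slots of r moves, by pair symmetry,
    between the first two.  The obstruction D to moving from the first pair to the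
    second one is then alternating in u, v and in z, w, and cyclic in u, v, z by
    the Bianchi identity, so it is totally alternating; exchanging the two pairs is
    an even permutation, while pair symmetry makes D change sign under it. *)
Lemma curvature_transfer (J : T -> T) :
  (forall u v z w, r u v (J z) w = r u v z (J w)) ->
  forall u v z w, r (J u) v z w = r u v (J z) w.
Proof.
move=> symJ u v z w.
have symJ12 a b c d : r (J a) b c d = r a (J b) c d.
  by rewrite curvature_pair_symmetry symJ curvature_pair_symmetry.
pose D a b c d := r (J a) b c d - r a b (J c) d.
have D12 a b c d : D a b c d = - D b a c d.
  by rewrite /D symJ12 (skew12 a (J b)) (skew12 a b); ring.
have D34 a b c d : D a b c d = - D a b d c.
  by rewrite /D symJ (skew34 (J a)) (skew34 a b); ring.
have Dcyc a b c d : D a b c d = D b c a d.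
  have := bianchi a b (J c) d; have := bianchi (J a) b c d.
  by rewrite /D (symJ12 c a) -(symJ12 b c); lra.
have Dpair a b c d : D a b c d = - D c d a b.
  rewrite /D (curvature_pair_symmetry (J a)) (curvature_pair_symmetry a).
  by ring.
have h1 := Dpair u v z w.
have h2 : D z w u v = D u v z w.
  rewrite (Dcyc z w u v) (D34 w u z v) (D12 w u v z) opprK.
  by rewrite (Dcyc u w v z) (Dcyc w v u z) (D34 v u w z) (D12 v u z w) opprK.
by rewrite -/(D u v z w) in h1; move: h1; rewrite h2 /D; lra.
Qed.

End CurvatureTensors.

Lemma bilinear_form_inj (K : pzRingType) d (A B : 'M[K]_d) :
  (forall z w : 'cV[K]_d, (z^T *m A *m w) 0 0 = (z^T *m B *m w) 0 0) -> A = B.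
Proof.
move=> AB; apply/matrixP => i j; move: (AB (delta_mx i 0) (delta_mx j 0)).
by rewrite trmx_delta -!rowE -!colE !mxE.
Qed.

Section CurvatureOperators.
Context {K : realFieldType} {d : nat}.
Variables (g J1 J2 J3 : 'M[K]_d) (F : 'cV[K]_d -> 'cV[K]_d -> 'M[K]_d).
Hypothesis g_unit : g \in unitmx.
Hypothesis g_sym : g^T = g.
Hypothesis J123 : J1 = J2 *m J3.
Hypothesis J132 : J1 = - (J3 *m J2).
Hypothesis J312 : J3 = J1 *m J2.
Hypothesis J321 : J3 = - (J2 *m J1).
Hypothesis J1_sqr : J1 *m J1 = - 1%:M.
Hypothesis J2_sqr : J2 *m J2 = - 1%:M.
Hypothesis J1_skew : J1^T *m g = - (g *m J1).
Hypothesis J2_sym : J2^T *m g = g *m J2.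
Hypothesis J3_sym : J3^T *m g = g *m J3.
Hypothesis F_alt : forall u v, F u v = - F v u.
Hypothesis F_skew : forall u v, (F u v)^T *m g = - (g *m F u v).
Hypothesis F_bianchi : forall u v w,
  F u v *m w + F v w *m u + F w u *m v = 0.

(** The tensor R(u,v,z,w) = g(F(u,v)z,w), written with the transpose of F u v on
    the left so that the skewness of F is used as a matrix identity. *)
Definition curv_tensor (u v z w : 'cV[K]_d) : K :=
  (z^T *m ((F u v)^T *m g) *m w) 0 0.

Lemma curv_tensor_skew12 u v z w : curv_tensor u v z w = - curv_tensor v u z w.
Proof. by rewrite /curv_tensor (F_alt u) linearN/= mulNmx mulmxN mulNmx mxE. Qed.

Lemma curv_tensor_skew34 u v z w : curv_tensor u v z w = - curv_tensor u v w z.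
Proof.
rewrite /curv_tensor {1}F_skew mulmxN mulNmx mxE; congr (- _).
have -> (M : 'M[K]_1) : M 0 0 = M^T 0 0 by rewrite mxE.
by rewrite !trmx_mul trmxK g_sym !mulmxA.
Qed.

Lemma curv_tensor_bianchi u v z w :
  curv_tensor u v z w + curv_tensor v z u w + curv_tensor z u v w = 0.
Proof.
have E a b c : curv_tensor a b c w = ((F a b *m c)^T *m g *m w) 0 0.
  by rewrite /curv_tensor trmx_mul !mulmxA.
have := congr1 (fun y => (y^T *m g *m w) 0 0) (F_bianchi u v z).
rewrite !E trmx0 !mul0mx [RHS]mxE => <-.
by rewrite !linearD/= !mulmxDl !addmxE.
Qed.

(** The two sides are recovered from their g-products with all vectors, since g is
    nondegenerate. *)
Lemma curv_tensor_inj A u v u' v' (s : K) :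
  (forall z w, curv_tensor u v (A *m z) w = s * curv_tensor u' v' z w) ->
  F u v *m A = s *: F u' v'.
Proof.
move=> h; have : (F u v *m A)^T *m g = (s *: F u' v')^T *m g.
  apply: bilinear_form_inj => z w.
  rewrite linearZ/= -scalemxAl -scalemxAr -scalemxAl [RHS]mxE -[in RHS]h.
  by rewrite /curv_tensor !trmx_mul !mulmxA.
by move/(congr1 (mulmx^~ (invmx g))); rewrite !mulmxK// => /trmx_inj.
Qed.

Lemma curv_tensor_symmetric J :
  J^T *m g = g *m J -> (forall u v, F u v *m J = J *m F u v) ->
  forall u v z w, curv_tensor u v (J *m z) w = curv_tensor u v z (J *m w).
Proof.
move=> symJ FJ u v z w; rewrite /curv_tensor trmx_mul.
congr (fun_of_matrix _ _ _).
rewrite -!mulmxA; congr (_ *m _); rewrite !mulmxA; congr (_ *m _).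
by rewrite -trmx_mul FJ trmx_mul -!mulmxA symJ.
Qed.

(** Pointwise form of the flatness of NH-manifolds with parallel J1, J2, J3: both
    J2 and J3 are g-symmetric and commute with F, so they move freely between the
    slots of [curv_tensor].  From R(J3 u,v,J2 z,w), moving J3 onto the third slot
    applies it after J2, while moving J2 away, J3 in, and J2 back applies it before
    J2; the two values are R(u,v,-J1 z,w) and R(u,v,J1 z,w). *)
Lemma hyperkahler_NH_flat :
  (forall u v, F u v *m J2 = J2 *m F u v) ->
  (forall u v, F u v *m J3 = J3 *m F u v) -> forall u v, F u v = 0.
Proof.
move=> FJ2 FJ3 u v.
have tr J := curvature_transfer curv_tensor_skew12 curv_tensor_skew34
  curv_tensor_bianchi (J := mulmx J).
have t2 := tr _ (curv_tensor_symmetric J2_sym FJ2).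
have t3 := tr _ (curv_tensor_symmetric J3_sym FJ3).
have t2' a b z w : curv_tensor a (J2 *m b) z w = curv_tensor a b (J2 *m z) w.
  by rewrite curv_tensor_skew12 t2 -curv_tensor_skew12.
have h z w : curv_tensor u v (J1 *m z) w = 0.
  have e1 : curv_tensor (J3 *m u) v (J2 *m z) w = - curv_tensor u v (J1 *m z) w.
    rewrite t3 mulmxA J132 mulNmx /curv_tensor linearN/= !mulNmx.
    by rewrite [in RHS]mxE opprK.
  have e2 : curv_tensor (J3 *m u) v (J2 *m z) w = curv_tensor u v (J1 *m z) w.
    by rewrite -t2' t3 t2' mulmxA -J123.
  by move: e1; rewrite e2; lra.
have F0 : F u v *m J1 = 0.
  by rewrite (@curv_tensor_inj J1 u v u v 0) ?scale0r// => z w; rewrite h mul0r.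
have := congr1 (mulmx^~ J1) F0.
by rewrite -mulmxA J1_sqr mulmxN mulmx1 mul0mx => /eqP; rewrite oppr_eq0 => /eqP.
Qed.

(** F(u,v) commutes with the skew J1, and pair symmetry transports this to the
    first two arguments of R. *)
Lemma kahler_first_pair :
  (forall u v, F u v *m J1 = J1 *m F u v) ->
  forall u v, F (J1 *m u) v = - F u (J1 *m v).
Proof.
move=> FJ1 u v.
have skewJ a b z w : curv_tensor a b (J1 *m z) w = - curv_tensor a b z (J1 *m w).
  rewrite /curv_tensor trmx_mul.
  have -> : z^T *m J1^T *m ((F a b)^T *m g) *m w =
      - (z^T *m ((F a b)^T *m g) *m (J1 *m w)).
    rewrite -!mulmxA -mulmxN; congr (_ *m _); rewrite !mulmxA -mulNmx.
    congr (_ *m _).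
    by rewrite -trmx_mul FJ1 trmx_mul -!mulmxA J1_skew mulmxN.
  by rewrite mxE.
have sym := curvature_pair_symmetry curv_tensor_skew12 curv_tensor_skew34
  curv_tensor_bianchi.
have := @curv_tensor_inj 1%:M (J1 *m u) v u (J1 *m v) (-1); rewrite mulmx1 scaleN1r.
by apply=> z w; rewrite mul1mx mulN1r sym skewJ sym.
Qed.

Lemma trace_entries (M : 'M[K]_d) :
  \tr M = \sum_(a < d) (M *m (delta_mx a 0 : 'cV[K]_d)) a 0.
Proof. by apply: eq_bigr => a _; rewrite -colE mxE. Qed.

(** The Kaehler identity between the Ricci form and the Ricci tensor.  In the trace
    of F(u,v) J1, Bianchi turns each F(u,v) J1 e_a into terms F(J1 e_a,.), in which
    J1 is moved to the other argument; what remains are two traces of the Ricci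
    type, taken at J1 u and J1 v. *)
Lemma ricci_form_trace :
  (forall u v, F u v *m J1 = J1 *m F u v) ->
  (forall v z : 'cV[K]_d, \sum_(a < d) (F (delta_mx a 0) v *m z) a 0 = 0) ->
  forall u v, \tr (F u v *m J1) = 0.
Proof.
move=> FJ1 ric u v; rewrite trace_entries.
have E a : ((F u v *m J1) *m (delta_mx a 0 : 'cV_d)) a 0 =
   (F (delta_mx a 0) (J1 *m u) *m v) a 0 - (F (delta_mx a 0) (J1 *m v) *m u) a 0.
  have := F_bianchi u v (J1 *m delta_mx a 0).
  rewrite (F_alt v) !kahler_first_pair// opprK !mulNmx -mulmxA.
  move/(congr1 (fun y : 'cV_d => y a 0)); rewrite !mxE; lra.
by rewrite (eq_bigr _ (fun a _ => E a)) sumrB !ric subrr.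
Qed.

(** Multiply the commutator by J3 and take traces: the left-hand side gives
    2 tr(f J1) = 0 and the right-hand side - s d, so s = 0 unless d = 0. *)
Lemma traceless_commutator (f : 'M[K]_d) (s : K) :
  f *m J1 = J1 *m f -> f *m J2 - J2 *m f = s *: J3 -> \tr (f *m J1) = 0 ->
  s *: J3 = 0.
Proof.
move=> fJ1 fJ2 tr0.
have : \tr ((f *m J2 - J2 *m f) *m (J2 *m J1)) = \tr (s *: (J3 *m (J2 *m J1))).
  by rewrite fJ2 scalemxAl.
have J3_sqr : J3 *m J3 = - 1%:M.
  by rewrite {1}J312 J321 mulmxN -mulmxA (mulmxA J2) J2_sqr mulNmx mul1mx
   mulmxN opprK J1_sqr.
have -> : J2 *m J1 = - J3 by rewrite J321 opprK.
rewrite !mulmxN J3_sqr opprK mxtraceZ mxtrace1.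
rewrite mulmxBl raddfN/= raddfB/=.
have -> : f *m J2 *m J3 = f *m J1 by rewrite -mulmxA -J123.
have -> : \tr (J2 *m f *m J3) = - \tr (f *m J1).
  by rewrite -mulmxA mxtrace_mulC -mulmxA -[J3 *m J2]opprK -J132 mulmxN raddfN.
rewrite tr0 opprK addr0 oppr0 => /esym/eqP; rewrite mulf_eq0 => /orP[/eqP->|].
  by rewrite scale0r.
rewrite pnatr_eq0 => /eqP d0; apply/matrixP => i.
by have : (i < 0)%N by apply: leq_trans (ltn_ord i) _; rewrite d0.
Qed.

End CurvatureOperators.

(** * Derivatives of matrix-valued maps *)

Section MatrixDerivatives.
Context {R : realType} {V : normedModType R}.
Implicit Types (x v : V).

Lemma is_derive_mxP m n (A : V -> 'M[R]_(m, n)) x v dA :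
  is_derive x v A dA <->
  forall i j, is_derive x v (fun y => A y i j : R) (dA i j).
Proof.
split=> [[dvA <-] i j|h].
  have /derivable_mxP dA' := dvA.
  by rewrite derive_mx// mxE; apply: DeriveDef.
have dvA : derivable A x v by apply/derivable_mxP => i j; case: (h i j).
apply: DeriveDef => //; rewrite derive_mx//; apply/matrixP => i j.
by rewrite mxE; case: (h i j).
Qed.

Lemma is_derive_mulmx m n p (A : V -> 'M[R]_(m, n)) (B : V -> 'M[R]_(n, p))
    x v dA dB :
  is_derive x v A dA -> is_derive x v B dB ->
  is_derive x v (fun y => A y *m B y) (dA *m B x + A x *m dB).
Proof.
move=> /is_derive_mxP hA /is_derive_mxP hB; apply/is_derive_mxP => i j.
have -> : (fun y => (A y *m B y) i j) =
    \sum_(k < n) ((fun y => A y i k : R) * (fun y => B y k j : R)).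
  by apply/funext => y; rewrite mxE fct_sumE.
have hk k : is_derive x v ((fun y => A y i k : R) * (fun y => B y k j : R))
    (dA i k * B x k j + A x i k * dB k j).
  have := is_deriveM (hA i k) (hB k j); rewrite /GRing.scale/=.
  by rewrite addrC [_ * dA i k]mulrC.
apply: (is_derive_eq (is_derive_sum hk)).
by rewrite !mxE big_split.
Qed.

Lemma is_derive_trmx m n (A : V -> 'M[R]_(m, n)) x v dA :
  is_derive x v A dA -> is_derive x v (fun y => (A y)^T) dA^T.
Proof.
move=> /is_derive_mxP hA; apply/is_derive_mxP => i j; rewrite mxE.
by have := hA j i; congr is_derive; apply/funext => y; rewrite mxE.
Qed.

Lemma is_derive_scale_mx m n (c : V -> R) (A : V -> 'M[R]_(m, n)) x v dc dA :
  is_derive x v c dc -> is_derive x v A dA ->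
  is_derive x v (fun y => c y *: A y) (dc *: A x + c x *: dA).
Proof.
move=> hc /is_derive_mxP hA; apply/is_derive_mxP => i j.
have -> : (fun y => (c y *: A y) i j) = c * (fun y => A y i j : R).
  by apply/funext => y; rewrite mxE.
apply: (is_derive_eq (is_deriveM hc (hA i j))).
by rewrite !mxE addrC /GRing.scale/= mulrC [X in _ + X]mulrC [X in _ + X]mulrC mulrC.
Qed.

End MatrixDerivatives.

(** * Symmetry of second derivatives *)

Section Schwarz.
Context {R : realType} {V : normedModType R}.

Lemma is_derive_line (f : V -> R) (x u : V) (s : R) :
  derivable f (s *: u + x) u ->
  is_derive s 1 (fun r : R => f (r *: u + x) : R) ('D_u f (s *: u + x)).
Proof.
have E : (fun h : R => h^-1 *: (((fun r : R => f (r *: u + x)) \o shift s) (h *: 1)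
     - f (s *: u + x)))
   = (fun h => h^-1 *: ((f \o shift (s *: u + x)) (h *: u) - f (s *: u + x))).
  apply/funext => h /=; rewrite addrA -scalerDl.
  by rewrite [h *: 1]mulr1.
by move=> df; apply: DeriveDef; rewrite /derivable /derive E.
Qed.

Lemma MVT_line (f : V -> R) (x u : V) (t : R) : 0 < t ->
  (forall s, 0 <= s <= t -> derivable f (s *: u + x) u) ->
  exists2 s, 0 <= s <= t & f (t *: u + x) - f x = t * 'D_u f (s *: u + x).
Proof.
move=> t0 df.
have hd s : 0 <= s <= t -> is_derive s 1 (fun r : R => f (r *: u + x) : R)
    ('D_u f (s *: u + x)) by move=> /df; exact: is_derive_line.
have [||s /itvP sI E] := MVT (f := fun r : R => f (r *: u + x))
  (df := fun s => 'D_u f (s *: u + x)) t0.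
- by move=> s /itvP sI; apply: hd; rewrite !sI.
- apply: derivable_within_continuous => s /itvP sI.
  by have [] : is_derive s 1 (fun r : R => f (r *: u + x) : R)
    ('D_u f (s *: u + x)) by apply: hd; rewrite !sI.
by exists s; rewrite ?sI//; move: E; rewrite scale0r add0r subr0 mulrC.
Qed.

(** Two applications of the mean value theorem: along u to the difference of f in
    the direction v, then along v to the derivative of f in the direction u. *)
Lemma second_difference (f : V -> R) (x u v : V) (t : R) : 0 < t ->
  (forall s r, 0 <= s <= t -> 0 <= r <= t ->
     derivable f (s *: u + (r *: v + x)) u /\
     derivable ('D_u f) (s *: u + (r *: v + x)) v) ->
  exists s r, [/\ 0 <= s <= t, 0 <= r <= t &
    f (t *: u + (t *: v + x)) - f (t *: u + x) - (f (t *: v + x) - f x)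
    = t * t * 'D_v ('D_u f) (s *: u + (r *: v + x))].
Proof.
move=> t0 df.
have tt : 0 <= t <= t by rewrite lexx ltW.
have z0 : 0 <= (0 : R) <= t by rewrite lexx ltW.
have d1 s : 0 <= s <= t -> derivable f (s *: u + (t *: v + x)) u.
  by move=> sI; have [h _] := df _ _ sI tt; exact: h.
have d2 s : 0 <= s <= t -> derivable f (s *: u + x) u.
  by move=> sI; have [h _] := df _ _ sI z0; rewrite scale0r add0r in h; exact: h.
pose k y := f (t *: v + y) - f y.
have E0 y : (t *: v + (y + x)) = y + (t *: v + x) by rewrite addrCA.
have kd s : 0 <= s <= t -> is_derive (s *: u + x) u k
   ('D_u f (s *: u + (t *: v + x)) - 'D_u f (s *: u + x)).
  move=> sI; apply: is_deriveB; last exact/derivableP/d2.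
  have E : (fun h : R => h^-1 *:
       (((fun y => f (t *: v + y)) \o shift (s *: u + x)) (h *: u)
        - f (t *: v + (s *: u + x))))
   = (fun h => h^-1 *: ((f \o shift (s *: u + (t *: v + x))) (h *: u)
     - f (s *: u + (t *: v + x)))).
    by apply/funext => h /=; rewrite !E0 [in X in f X]addrCA E0.
  by apply: DeriveDef; rewrite /derivable /derive E//; exact: d1.
have [|s sI E] := @MVT_line k x u t t0.
  by move=> s /kd[].
have [_ ks] := kd _ sI.
have [r rI F] : exists2 r, 0 <= r <= t & 'D_u f (t *: v + (s *: u + x)) -
    'D_u f (s *: u + x) = t * 'D_v ('D_u f) (r *: v + (s *: u + x)).
  apply: (@MVT_line ('D_u f) (s *: u + x) v t t0) => r rI; have [_] := df _ _ sI rI.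
  by rewrite addrCA => h; exact: h.
exists s, r; split; [exact: sI|exact: rI|].
by rewrite -mulrA [s *: u + _]addrCA -F [t *: v + (s *: u + x)]addrCA -ks -E /k E0.
Qed.

(** The second difference of f over a small parallelogram is symmetric in u and v,
    and is t^2 times a value of either mixed derivative inside the parallelogram;
    by continuity both values are close to the values at x. *)
Lemma schwarz (f : V -> R) (x u v : V) :
  (\forall y \near x, [/\ derivable f y u, derivable f y v,
     derivable ('D_u f) y v & derivable ('D_v f) y u]) ->
  {for x, continuous ('D_v ('D_u f))} -> {for x, continuous ('D_u ('D_v f))} ->
  'D_v ('D_u f) x = 'D_u ('D_v f) x.
Proof.
move=> df cvu cuv; apply/eqP; rewrite -subr_eq0 -normr_le0.
apply/ler_addgt0Pl => e e0; rewrite addr0; have e2 : 0 < e / 2 by rewrite divr_gt0.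
have nvu : \forall y \near x,
    `|'D_v ('D_u f) x - 'D_v ('D_u f) y| < e / 2.
  by move/cvgrPdist_lt : cvu; apply.
have nuv : \forall y \near x,
    `|'D_u ('D_v f) x - 'D_u ('D_v f) y| < e / 2.
  by move/cvgrPdist_lt : cuv; apply.
have /nbhs_ballP[r /= r0 rP] : \forall y \near x,
    [/\ derivable f y u, derivable f y v, derivable ('D_u f) y v &
        derivable ('D_v f) y u] /\
    (`|'D_v ('D_u f) x - 'D_v ('D_u f) y| < e / 2 /\
     `|'D_u ('D_v f) x - 'D_u ('D_v f) y| < e / 2).
  by apply: filterI; [exact: df|apply: filterI; [exact: nvu|exact: nuv]].
(* A parallelogram of side t at x lies in the ball of radius r. *)
have [t t0 tb] : exists2 t : R, 0 < t & forall a b, 0 <= a <= t -> 0 <= b <= t ->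
    ball x r (a *: u + (b *: v + x)).
  pose N := `|u| + `|v| + 1.
  have N0 : 0 < N by rewrite ltr_wpDl// addr_ge0.
  exists (r / N); first by rewrite divr_gt0.
  move=> a b /andP[a0 ar] /andP[b0 br]; rewrite -ball_normE /ball_/=.
  rewrite addrA opprD addrCA subrr addr0 normrN (le_lt_trans (ler_normD _ _))//.
  rewrite !normrZ !ger0_norm//.
  have h1 : a * `|u| <= r / N * `|u| by rewrite ler_wpM2r.
  have h2 : b * `|v| <= r / N * `|v| by rewrite ler_wpM2r.
  have h3 : r = r / N * `|u| + r / N * `|v| + r / N.
    by rewrite -!mulrDr -[X in _ + X]mulr1 -mulrDr divfK ?gt_eqF.
  have h4 : 0 < r / N by rewrite divr_gt0.
  lra.
have tri (a b w : R) : `|a - w| < e / 2 -> `|b - w| < e / 2 -> `|a - b| <= e.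
  move=> h h'; rewrite [e]splitr -(subrKA w); apply: le_trans (ler_normD _ _) _.
  by rewrite (distrC w) lerD// ltW.
have bC a b : a *: v + (b *: u + x) = b *: u + (a *: v + x) by exact: addrCA.
have [|s [q [sI qI E]]] := @second_difference f x u v t t0.
  move=> a b aI bI; have [[h1 _ h2 _] _] := rP _ (tb _ _ aI bI).
  by split; [exact: h1|exact: h2].
have [|s' [q' [sI' qI' E']]] := @second_difference f x v u t t0.
  move=> a b aI bI; have [[_ h1 _ h2] _] := rP _ (tb _ _ bI aI).
  by rewrite bC; split; [exact: h1|exact: h2].
have [_ [h _]] := rP _ (tb _ _ sI qI).
have [_ [_ h']] := rP _ (tb _ _ qI' sI').
have EE : 'D_v ('D_u f) (s *: u + (q *: v + x)) =
          'D_u ('D_v f) (q' *: u + (s' *: v + x)).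
  have tt0 : t * t != 0 by rewrite mulf_neq0// gt_eqF.
  rewrite (bC t t) (bC s' q') in E'; apply: (mulfI tt0).
  have sub4 (a b c d : R) : a - b - (c - d) = a - c - (b - d) by ring.
  by apply: (etrans (esym E)); apply: etrans E'; exact: sub4.
by rewrite EE in h; exact: tri h h'.
Qed.

End Schwarz.
Section SmoothMaps.
Context {R : realType} {V : normedModType R}.
Implicit Types (x u v : V) (U : set V).

Lemma smooth_cst (W : normedModType R) U (w : W) : smooth_on U (fun _ : V => w).
Proof.
move=> k; elim: k w => [|k IH] w /=; first by move=> x _; exact: cvg_cst.
split=> [x _|v]; first exact: differentiable_cst.
have -> : 'D_v (fun=> w) = fun _ : V => 0 :> W; last exact: IH.
by apply/funext => x; exact: (derive_cst w).
Qed.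

Lemma smooth_derive (W : normedModType R) U (f : V -> W) v :
  smooth_on U f -> smooth_on U ('D_v f).
Proof. by move=> sf k; have [_] := sf k.+1; apply. Qed.

Lemma smooth_differentiable (W : normedModType R) U (f : V -> W) x :
  smooth_on U f -> U x -> differentiable f x.
Proof. by move=> sf; have [h _] := sf 1; exact: h. Qed.

Lemma smooth_is_derive (W : normedModType R) U (f : V -> W) x v :
  smooth_on U f -> U x -> is_derive x v f ('D_v f x).
Proof.
move=> sf Ux.
by apply/derivableP/diff_derivable/(smooth_differentiable sf).
Qed.

Lemma near_open U x (P : V -> Prop) :
  open U -> U x -> (forall y, U y -> P y) -> \forall y \near x, P y.
Proof. by move=> oU Ux UP; apply: filterS (open_nbhs_nbhs (conj oU Ux)). Qed.

Lemma derive_sum_dir (W : normedModType R) (f : V -> W) x n (a : 'I_n -> R)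
    (e : 'I_n -> V) : differentiable f x ->
  'D_(\sum_(k < n) a k *: e k) f x = \sum_(k < n) a k *: 'D_(e k) f x.
Proof.
move=> df; rewrite !deriveE// linear_sum; apply: eq_bigr => k _.
by rewrite linearZ deriveE.
Qed.

Lemma derive_entry m n U (f : V -> 'M[R]_(m, n)) i j x v :
  smooth_on U f -> U x -> 'D_v (fun y => f y i j : R) x = 'D_v f x i j.
Proof.
move=> sf Ux; have /is_derive_mxP/(_ i j) h := smooth_is_derive v sf Ux.
by case: h.
Qed.

(** Near x the derivative of an entry is an entry of the derivative; as this holds
    on an open set only, the second derivative must be compared through germs. *)
Lemma derive2_entry m n U (f : V -> 'M[R]_(m, n)) i j x u v :
  open U -> smooth_on U f -> U x ->
  derivable ('D_u (fun y => f y i j : R)) x v /\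
  'D_v ('D_u (fun y => f y i j : R)) x = 'D_v ('D_u f) x i j.
Proof.
move=> oU sf Ux.
have /is_derive_mxP/(_ i j) h := smooth_is_derive v (smooth_derive u sf) Ux.
have [//] : is_derive x v ('D_u (fun y => f y i j : R)) ('D_v ('D_u f) x i j).
apply: near_eq_is_derive h; apply: (near_open oU Ux) => y Uy.
by rewrite (derive_entry _ _ _ sf Uy).
Qed.

Lemma derive2_entry_continuous m n U (f : V -> 'M[R]_(m, n)) i j x u v :
  open U -> smooth_on U f -> U x ->
  {for x, continuous ('D_v ('D_u (fun y => f y i j : R)))}.
Proof.
move=> oU sf Ux.
have c : {for x, continuous (fun y => 'D_v ('D_u f) y i j)}.
  apply: (@continuous_comp _ _ _ ('D_v ('D_u f)) (fun M : 'M[R]_(m, n) => M i j)).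
    exact: (smooth_derive v (smooth_derive u sf)) 0%N x Ux.
  exact: coord_continuous.
rewrite /prop_for /continuous_at (derive2_entry _ _ _ _ oU sf Ux).2.
apply: cvg_trans c; apply: near_eq_cvg; apply: (near_open oU Ux) => y Uy.
by rewrite (derive2_entry _ _ _ _ oU sf Uy).2.
Qed.

Lemma schwarz_mx m n U (f : V -> 'M[R]_(m, n)) x u v :
  open U -> smooth_on U f -> U x -> 'D_v ('D_u f) x = 'D_u ('D_v f) x.
Proof.
move=> oU sf Ux; apply/matrixP => i j.
have [_ euv] := derive2_entry i j u v oU sf Ux.
have [_ evu] := derive2_entry i j v u oU sf Ux.
apply: (etrans (esym euv)); apply: etrans evu.
have c (w w' : V) := @derive2_entry_continuous m n U f i j x w w' oU sf Ux.
apply: (schwarz _ (c u v) (c v u)).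
apply: (near_open oU Ux) => y Uy.
have h w : derivable (fun y => f y i j : R) y w.
  by have /is_derive_mxP/(_ i j)[] := smooth_is_derive w sf Uy.
have h2 (w w' : V) := (@derive2_entry m n U f i j y w w' oU sf Uy).1.
by split; [exact: h|exact: h|exact: h2|exact: h2].
Qed.

End SmoothMaps.

Lemma smooth_onS (R : realType) (V W : normedModType R) (U U' : set V)
    (f : V -> W) : U' `<=` U -> smooth_on U f -> smooth_on U' f.
Proof.
move=> UU' sf k; elim: k f sf => [|k IH] f sf.
  by move=> x U'x; exact: (sf 0%N x (UU' _ U'x)).
split=> [x U'x|v]; first exact: (smooth_differentiable sf (UU' _ U'x)).
by apply: IH; exact: smooth_derive.
Qed.

(** * The Ricci identity *)

(** The two sides of the hypothesis are the values of D_u D_v T and D_v D_u T that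
    come out of differentiating twice the equation of [ricci_identity]. *)
Lemma ricci_identity_algebra (R : realFieldType) p q (T Eu Ev dEu dEv : 'M[R]_(p, q))
    (Bu Bv dBu dBv : 'M[R]_p) (Cu Cv dCu dCv : 'M[R]_q) :
  (T *m Cu - Bu *m T + Eu) *m Cv + T *m dCv
    - (dBv *m T + Bv *m (T *m Cu - Bu *m T + Eu)) + dEv
  = (T *m Cv - Bv *m T + Ev) *m Cu + T *m dCu
    - (dBu *m T + Bu *m (T *m Cv - Bv *m T + Ev)) + dEu ->
  (dBv - dBu + (Bu *m Bv - Bv *m Bu)) *m T
    - T *m (dCv - dCu + (Cu *m Cv - Cv *m Cu))
  = (dEv + Bu *m Ev - Ev *m Cu) - (dEu + Bv *m Eu - Eu *m Cv).
Proof.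
rewrite !(mulmxDl, mulmxDr, mulmxBl, mulmxBr, mulNmx, mulmxN, mulmxA).
move=> /matrixP H; apply/matrixP => i j; move: (H i j).
by rewrite !(addmxE, oppmxE); lra.
Qed.

Section Curvature.
Context {R : realType} {V : normedModType R}.

(** The curvature (dB + B /\ B)(u,v) of the matrix-valued 1-form B, where B w is
    the function obtained by contracting the form with the constant vector w. *)
Definition curv n (B : V -> V -> 'M[R]_n) (x u v : V) : 'M[R]_n :=
  'D_u (B v) x - 'D_v (B u) x + (B u x *m B v x - B v x *m B u x).

Lemma curv_cst0 n x u v : curv (fun _ _ : V => 0 : 'M[R]_n) x u v = 0.
Proof. by rewrite /curv !(derive_cst (0 : 'M[R]_n)) mulmx0 !subrr addr0. Qed.

(** Regard B and C as connections and T as a section of Hom(C,B); the equation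
    dT = T C - B T + E says that E is the covariant derivative of T.  The
    antisymmetrized second covariant derivative of T is then the action of the
    curvatures.  The same identity serves below for vector fields (q = 1, C = 0),
    for endomorphisms (B = C) and for bilinear forms (B = - C^T). *)
Lemma ricci_identity p q (T : V -> 'M[R]_(p, q)) (B : V -> V -> 'M[R]_p)
    (C : V -> V -> 'M[R]_q) (E : V -> V -> 'M[R]_(p, q)) (x u v : V) :
  (forall w, \forall y \near x,
     'D_w T y = T y *m C w y - B w y *m T y + E w y) ->
  (forall w, derivable T x w) -> (forall w w', derivable (B w) x w') ->
  (forall w w', derivable (C w) x w') -> (forall w w', derivable (E w) x w') ->
  'D_u ('D_v T) x = 'D_v ('D_u T) x ->
  curv B x u v *m T x - T x *m curv C x u v =
    ('D_u (E v) x + B u x *m E v x - E v x *m C u x)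
    - ('D_v (E u) x + B v x *m E u x - E u x *m C v x).
Proof.
move=> hT /(_ _)/derivableP dT dB dC dE.
have D2 w w' : 'D_w ('D_w' T) x =
    (T x *m C w x - B w x *m T x + E w x) *m C w' x + T x *m 'D_w (C w') x
    - ('D_w (B w') x *m T x
       + B w' x *m (T x *m C w x - B w x *m T x + E w x)) + 'D_w (E w') x.
  rewrite (near_eq_derive w (hT w')) -(nbhs_singleton (hT w)).
  have h1 := is_derive_mulmx (dT w) (derivableP (dC w' w)).
  have h2 := is_derive_mulmx (derivableP (dB w' w)) (dT w).
  by have [_] := is_deriveD (is_deriveB h1 h2) (derivableP (dE w' w)).
by rewrite !D2; exact: ricci_identity_algebra.
Qed.

End Curvature.

(** * Covariant derivatives in a chart *)

Section LocalConnection.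
Context {R : realType} {d : nat}.
Variables (U : set 'cV[R]_d) (Gam : 'cV[R]_d -> 'I_d -> 'M[R]_d).
Hypothesis U_open : open U.
Hypothesis Gam_smooth : forall k, smooth_on U (fun y => Gam y k).
Implicit Types (x y u v w : 'cV[R]_d) (X Y Z : 'cV[R]_d -> 'cV[R]_d).

Definition conn u y : 'M[R]_d := \sum_(k < d) u k 0 *: Gam y k.

Lemma conn_derivable x u w : U x -> derivable (conn u) x w.
Proof.
move=> Ux.
have h k : is_derive x w (u k 0 *: (fun y => Gam y k))
    (u k 0 *: 'D_w (fun y => Gam y k) x).
  exact/is_deriveZ/(smooth_is_derive w (@Gam_smooth k) Ux).
have -> : conn u = \sum_(k < d) (u k 0 *: (fun y => Gam y k)).
  by apply/funext => y; rewrite fct_sumE.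
by have [] := is_derive_sum h.
Qed.

Lemma coord_covE X Y y :
  coord_cov Gam X Y y = 'D_(X y) Y y + conn (X y) y *m Y y.
Proof.
rewrite /coord_cov /conn mulmx_suml; congr (_ + _).
by apply: eq_bigr => k _; rewrite scalemxAl.
Qed.

Lemma col_frame u : u = \sum_(k < d) u k 0 *: delta_mx k 0.
Proof.
apply/matrixP => i j; rewrite summxE (bigD1 i)//= big1 ?addr0 => [|k ki].
  by rewrite !mxE !ord1 !eqxx mulr1.
by rewrite !mxE eq_sym (negbTE ki) mulr0.
Qed.

Section CovariantDifferential.
Variable Z : 'cV[R]_d -> 'cV[R]_d.
Hypothesis Z_smooth : smooth_on U Z.

(** The covariant derivative of Z in a direction v that is independent of the base
    point; [coord_cov] is recovered by letting v vary with y. *)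
Definition cov_diff v y : 'cV[R]_d := 'D_v Z y + conn v y *m Z y.

Lemma cov_diff_frame v y : U y ->
  cov_diff v y = \sum_(k < d) v k 0 *: cov_diff (delta_mx k 0) y.
Proof.
move=> Uy; rewrite /cov_diff {1}(col_frame v).
rewrite derive_sum_dir; last exact: smooth_differentiable Z_smooth Uy.
under [RHS]eq_bigr do rewrite scalerDr.
rewrite big_split/=; congr (_ + _); rewrite /conn mulmx_suml.
apply: eq_bigr => k _; rewrite -scalemxAl; congr (_ *: (_ *m _)).
rewrite (bigD1 k)//= big1 ?addr0 => [|l lk].
  by rewrite !mxE !eqxx scale1r.
by rewrite mxE (negbTE lk) scale0r.
Qed.

Lemma cov_diffB u v y : U y ->
  cov_diff (u - v) y = cov_diff u y - cov_diff v y.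
Proof.
move=> Uy; rewrite !(cov_diff_frame _ Uy) -sumrB.
by apply: eq_bigr => k _; rewrite addmxE oppmxE scalerBl.
Qed.

Lemma cov_diff_derivable x v w : U x -> derivable (cov_diff v) x w.
Proof.
move=> Ux.
have h := smooth_is_derive w (smooth_derive v Z_smooth) Ux.
have h' := is_derive_mulmx (derivableP (conn_derivable (u := v) (w := w) Ux))
  (smooth_is_derive w Z_smooth Ux).
by have [] := is_deriveD h h'.
Qed.

(** Product rule for the contraction of the covariant differential of Z with a
    vector field Y: the second term differentiates with Y frozen at its value at
    x. *)
Lemma derive_cov_diff_field Y x w : smooth_on U Y -> U x ->
  'D_w (fun y => cov_diff (Y y) y) x
  = cov_diff ('D_w Y x) x + 'D_w (cov_diff (Y x)) x.
Proof.
move=> + Ux.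
pose S (a : 'cV[R]_d) := \sum_(k < d) a k 0 *: 'D_w (cov_diff (delta_mx k 0)) x.
have key Y' : smooth_on U Y' -> 'D_w (fun y => cov_diff (Y' y) y) x
    = cov_diff ('D_w Y' x) x + S (Y' x).
  move=> sY.
  have hk k : is_derive x w (fun y => Y' y k 0 *: cov_diff (delta_mx k 0) y)
     ('D_w Y' x k 0 *: cov_diff (delta_mx k 0) x
      + Y' x k 0 *: 'D_w (cov_diff (delta_mx k 0)) x).
    apply: is_derive_scale_mx; last exact/derivableP/cov_diff_derivable.
    by have /is_derive_mxP := smooth_is_derive w sY Ux; apply.
  have nE : \forall y \near x, cov_diff (Y' y) y =
      (\sum_(k < d) fun y => Y' y k 0 *: cov_diff (delta_mx k 0) y) y.
    apply: (near_open U_open Ux) => y Uy.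
    by rewrite (cov_diff_frame _ Uy) fct_sumE.
  rewrite (near_eq_derive w nE); have [_ ->] := is_derive_sum hk.
  by rewrite big_split/= -cov_diff_frame.
move=> sY; rewrite key//; congr (_ + _).
rewrite (key _ (@smooth_cst R _ _ U (Y x))).
rewrite (derive_cst (Y x)) -[0 in RHS](subrr (0 : 'cV[R]_d)) cov_diffB//.
by rewrite subrr add0r.
Qed.

End CovariantDifferential.

(** Tensoriality of the curvature.  Freezing X and Y at x produces the terms
    nabla_(D_X Y) Z and nabla_(D_Y X) Z, which cancel against nabla_[X,Y] Z; the
    remaining commutator of covariant derivatives in fixed directions is the Ricci
    identity for Z. *)
Lemma curvatureE X Y Z x :
  smooth_on U X -> smooth_on U Y -> smooth_on U Z -> U x ->
  coord_cov Gam X (coord_cov Gam Y Z) x - coord_cov Gam Y (coord_cov Gam X Z) x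
  - coord_cov Gam (lie_bracket X Y) Z x = curv conn x (X x) (Y x) *m Z x.
Proof.
move=> sX sY sZ Ux.
have E W : coord_cov Gam W Z = fun y => cov_diff Z (W y) y.
  by apply/funext => y; rewrite coord_covE.
have dE W w : smooth_on U W -> 'D_w (coord_cov Gam W Z) x
    = cov_diff Z ('D_w W x) x + 'D_w (cov_diff Z (W x)) x.
  by rewrite E => sW; exact: derive_cov_diff_field.
rewrite (coord_covE X (coord_cov Gam Y Z)) (coord_covE Y (coord_cov Gam X Z)).
rewrite !dE//.
set u := X x; set v := Y x.
have rI : curv conn x u v *m Z x =
    'D_u (cov_diff Z v) x + conn u x *m cov_diff Z v x
    - ('D_v (cov_diff Z u) x + conn v x *m cov_diff Z u x).
  have := @ricci_identity R _ d 1 Z conn (fun _ _ => 0) (cov_diff Z) x u v.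
  rewrite (@curv_cst0 R 'cV[R]_d 1) !mulmx0 !subr0; apply.
  - move=> w; near=> y; rewrite mulmx0 sub0r /cov_diff addrC addrK //.
  - by move=> w; have [] := smooth_is_derive w sZ Ux.
  - by move=> w w'; exact: conn_derivable.
  - by move=> w w'; exact: derivable_cst.
  - by move=> w w'; exact: cov_diff_derivable.
  - exact: schwarz_mx U_open sZ Ux.
rewrite rI !E /lie_bracket cov_diffB//.
have cancel_ab (a b p q r s : 'cV[R]_d) :
    a + p + q - (b + r + s) - (a - b) = p + q - (r + s).
  by apply/matrixP => i j; rewrite !(addmxE, oppmxE); ring.
exact: cancel_ab.
Unshelve. all: by end_near. Qed.

End LocalConnection.

(** * Curvature of a metric torsion-free connection *)

(** Here A^T g + g A is the derivative of a parallel form g and J A - A J + S that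
    of an endomorphism J with covariant derivative S: the hypothesis is the
    derivative of the relation J^T g = s g J, and S inherits that relation. *)
Lemma symmetry_of_remainder (R : realFieldType) d (g A J S : 'M[R]_d) (s : R) :
  J^T *m g = s *: (g *m J) ->
  (J *m A - A *m J + S)^T *m g + J^T *m (A^T *m g + g *m A)
  = s *: ((A^T *m g + g *m A) *m J + g *m (J *m A - A *m J + S)) ->
  S^T *m g = s *: (g *m S).
Proof.
move=> H.
have e1 : (J *m A)^T *m g = s *: (A^T *m g *m J).
  by rewrite trmx_mul -!mulmxA H -scalemxAr.
have e2 : J^T *m (g *m A) = s *: (g *m J *m A) by rewrite mulmxA H -scalemxAl.
have e3 : (A *m J)^T *m g = J^T *m (A^T *m g) by rewrite trmx_mul mulmxA.
rewrite linearD/= linearB/= !mulmxDl !mulNmx !mulmxDr mulmxN e1 e2 e3 !mulmxA.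
move/matrixP => E; apply/matrixP => i j; move: (E i j).
by rewrite !(addmxE, oppmxE, scalemxE); lra.
Qed.

Section LeviCivitaCurvature.
Context {R : realType} {d : nat}.
Variables (U : set 'cV[R]_d) (Gam : 'cV[R]_d -> 'I_d -> 'M[R]_d).
Hypothesis U_open : open U.
Hypothesis Gam_smooth : forall k, smooth_on U (fun y => Gam y k).
Implicit Types (x y u v w : 'cV[R]_d).
Local Notation A := (conn Gam).

Lemma curv_alt x u v : curv A x u v = - curv A x v u.
Proof. by rewrite /curv opprD !opprB. Qed.

(** First Bianchi identity: torsion-freeness A_a b = A_b a and its derivative make
    the twelve terms cancel in pairs. *)
Lemma curv_bianchi x u v w :
  (forall y a b, U y -> A a y *m b = A b y *m a) -> U x ->
  curv A x u v *m w + curv A x v w *m u + curv A x w u *m v = 0.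
Proof.
move=> tf Ux.
have dtf (a b c : 'cV[R]_d) : 'D_c (A a) x *m b = 'D_c (A b) x *m a.
  have dc (e f : 'cV[R]_d) : is_derive x c (fun y => A e y *m f) ('D_c (A e) x *m f).
    have dA := conn_derivable Gam_smooth (u := e) (w := c) Ux.
    have := is_derive_mulmx (derivableP dA) (is_derive_cst f x c).
    by rewrite mulmx0 addr0.
  have [_ <-] := dc a b; have [_ <-] := dc b a.
  by apply: near_eq_derive; apply: (near_open U_open Ux) => y Uy; exact: tf.
have E (a b c : 'cV[R]_d) : curv A x a b *m c = 'D_a (A b) x *m c - 'D_b (A a) x *m c
    + (A a x *m (A b x *m c) - A b x *m (A a x *m c)).
  by rewrite /curv mulmxDl !mulmxBl !mulmxA.
rewrite (E u v w) (E v w u) (E w u v).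
have cyc (a b c p q r a' b' c' p' q' r' : 'cV[R]_d) :
    a = a' -> b = b' -> c = c' -> p = p' -> q = q' -> r = r' ->
    a - b + (p - q) + (b' - c + (q' - r)) + (c' - a' + (r' - p')) = 0.
  move=> <- <- <- <- <- <-.
  by apply/matrixP => i j; rewrite !(addmxE, oppmxE) mxE; ring.
apply: cyc; [exact: dtf|exact: dtf|exact: dtf| | |].
all: by congr (_ *m _); exact: tf.
Qed.

Lemma curv_opp_tr x u v : U x ->
  curv (fun w y => - (A w y)^T) x u v = - (curv A x u v)^T.
Proof.
move=> Ux.
have dE a b : 'D_a (fun y => - (A b y)^T) x = - ('D_a (A b) x)^T.
  have dA := conn_derivable Gam_smooth (u := b) (w := a) Ux.
  have h := is_derive_trmx (derivableP dA).
  by have [_] := is_deriveN h.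
have gen (X Y P Q : 'M[R]_d) : - X^T - - Y^T + (- P^T *m - Q^T - - Q^T *m - P^T)
    = - (X - Y + (P *m Q - Q *m P))^T.
  rewrite !mulmxN !mulNmx !opprK -!trmx_mul.
  rewrite linearD/= !linearB/=; apply/matrixP => i j.
  by rewrite !(addmxE, oppmxE); ring.
by rewrite /curv !dE; exact: gen.
Qed.

(** The Ricci identity for the parallel form g, a section of Hom(V,V'), where the
    dual V' carries the connection - A^T. *)
Lemma curv_skew (g : 'cV[R]_d -> 'M[R]_d) x u v :
  smooth_on U g ->
  (forall y w, U y -> 'D_w g y = (A w y)^T *m g y + g y *m A w y) -> U x ->
  (curv A x u v)^T *m g x = - (g x *m curv A x u v).
Proof.
move=> sg dg Ux.
have := @ricci_identity R _ d d g (fun w y => - (A w y)^T) A (fun _ _ => 0) x u v.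
rewrite !(derive_cst (0 : 'M[R]_d)) curv_opp_tr//.
rewrite !mulmx0 !mul0mx !subr0 !addr0 mulNmx subrr.
move=> h; apply/esym/eqP; rewrite -subr_eq0 addrC; apply/eqP; apply: h.
- move=> w; apply: (near_open U_open Ux) => y Uy.
  by rewrite dg// mulNmx opprK addr0 addrC.
- by move=> w; have [] := smooth_is_derive w sg Ux.
- move=> w w'; apply: derivableN.
  have dA := conn_derivable Gam_smooth (u := w) (w := w') Ux.
  by have [] := is_derive_trmx (derivableP dA).
- by move=> w w'; exact: conn_derivable.
- by move=> w w'; exact: derivable_cst.
- exact: schwarz_mx U_open sg Ux.
Qed.

Lemma curv_commute (J : 'cV[R]_d -> 'M[R]_d) x u v :
  smooth_on U J ->
  (forall y w, U y -> 'D_w J y = J y *m A w y - A w y *m J y) -> U x ->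
  curv A x u v *m J x = J x *m curv A x u v.
Proof.
move=> sJ dJ Ux.
have := @ricci_identity R _ d d J A A (fun _ _ => 0) x u v.
rewrite !(derive_cst (0 : 'M[R]_d)) !mulmx0 !mul0mx !subr0 !addr0 subrr.
move=> h; apply/eqP; rewrite -subr_eq0; apply/eqP.
apply: h.
- move=> w; apply: (near_open U_open Ux) => y Uy; by rewrite dJ// addr0.
- by move=> w; have [] := smooth_is_derive w sJ Ux.
- by move=> w w'; exact: conn_derivable.
- by move=> w w'; exact: conn_derivable.
- by move=> w w'; exact: derivable_cst.
- exact: schwarz_mx U_open sJ Ux.
Qed.

(** The Ricci identity for J, whose covariant derivative is om (x) K.  The
    derivative of K contributes om (x) om (x) J, which is symmetric in u and v and
    disappears, leaving the exterior derivative of om. *)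
Lemma curv_commutator (J K : 'cV[R]_d -> 'M[R]_d) (om : 'cV[R]_d -> 'rV[R]_d) x u v :
  smooth_on U J -> smooth_on U K -> smooth_on U om ->
  (forall y w, U y ->
     'D_w J y = J y *m A w y - A w y *m J y + covec (om y) w *: K y) ->
  (forall y w, U y ->
     'D_w K y = K y *m A w y - A w y *m K y - covec (om y) w *: J y) ->
  U x ->
  curv A x u v *m J x - J x *m curv A x u v
  = (covec ('D_u om x) v - covec ('D_v om x) u) *: K x.
Proof.
move=> sJ sK som dJ dK Ux.
pose E w y := covec (om y) w *: K y.
have dom w w' : is_derive x w' (fun y => covec (om y) w) (covec ('D_w' om x) w).
  have := is_derive_mulmx (smooth_is_derive w' som Ux) (is_derive_cst w x w').
  by rewrite mulmx0 addr0 => /is_derive_mxP/(_ 0 0).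
have dE w w' : is_derive x w' (E w) (covec ('D_w' om x) w *: K x
    + covec (om x) w *: (K x *m A w' x - A w' x *m K x - covec (om x) w' *: J x)).
  by rewrite -dK//; exact: is_derive_scale_mx (dom _ _) (smooth_is_derive w' sK Ux).
have := @ricci_identity R _ d d J A A E x u v.
have [_ ->] := dE v u; have [_ ->] := dE u v.
move=> ->.
- rewrite /E.
  move: (covec _ v) (covec _ u) (covec (om x) u) (covec (om x) v) => a b c e.
  rewrite !scalerBr -!scalemxAl -!scalemxAr.
  apply/matrixP => i j.
  move: (K x) (J x) (K x *m A u x) (A u x *m K x) (K x *m A v x) (A v x *m K x).
  by move=> K0 J0 p q r s; rewrite !(addmxE, oppmxE) !mxE; ring.
- move=> w; apply: (near_open U_open Ux) => y Uy; by rewrite dJ.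
- by move=> w; have [] := smooth_is_derive w sJ Ux.
- by move=> w w'; exact: conn_derivable.
- by move=> w w'; exact: conn_derivable.
- by move=> w w'; have [] := dE w w'.
- exact: schwarz_mx U_open sJ Ux.
Qed.

Lemma parallel_symmetry (g J S : 'cV[R]_d -> 'M[R]_d) (s : R) y w :
  smooth_on U g -> smooth_on U J ->
  (forall y w, U y -> 'D_w g y = (A w y)^T *m g y + g y *m A w y) ->
  (forall y, U y -> (J y)^T *m g y = s *: (g y *m J y)) ->
  U y -> 'D_w J y = J y *m A w y - A w y *m J y + S y ->
  (S y)^T *m g y = s *: (g y *m S y).
Proof.
move=> sg sJ dg symJ Uy dJ.
have hJ := smooth_is_derive w sJ Uy; have hg := smooth_is_derive w sg Uy.
have [_ h1] := is_derive_mulmx (is_derive_trmx hJ) hg.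
have [_ h2] := is_deriveZ s (is_derive_mulmx hg hJ).
have := near_eq_derive w (near_open U_open Uy symJ).
rewrite h1 h2 dg// dJ.
exact: symmetry_of_remainder (symJ y Uy).
Qed.

End LeviCivitaCurvature.

(** * Quaternionic Kaehler structures in a chart *)

(** The connection 1-forms enter as om1, om2, om3 in a coordinate domain U; the
    adjunction hypotheses are written with the scalars -1 and 1 so that one lemma on
    g-skew and g-symmetric endomorphisms covers both cases. *)
Section QuaternionKahlerChart.
Context {R : realType} {d : nat}.
Variables (U : set 'cV[R]_d) (Gam : 'cV[R]_d -> 'I_d -> 'M[R]_d).
Variables (g J1 J2 J3 : 'cV[R]_d -> 'M[R]_d).
Variables (om1 om2 om3 : 'cV[R]_d -> 'rV[R]_d).
Hypothesis U_open : open U.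
Hypothesis Gam_smooth : forall k, smooth_on U (fun y => Gam y k).
Hypothesis g_smooth : smooth_on U g.
Hypothesis J1_smooth : smooth_on U J1.
Hypothesis J2_smooth : smooth_on U J2.
Hypothesis J3_smooth : smooth_on U J3.
Hypothesis om1_smooth : smooth_on U om1.
Local Notation A := (conn Gam).
Hypothesis torsion_free : forall y a b, U y -> A a y *m b = A b y *m a.
Hypothesis metric : forall y w, U y ->
  'D_w g y = (A w y)^T *m g y + g y *m A w y.
Hypothesis g_unit : forall y, U y -> g y \in unitmx.
Hypothesis g_sym : forall y, U y -> (g y)^T = g y.
Hypothesis J123 : forall y, U y -> J1 y = J2 y *m J3 y.
Hypothesis J132 : forall y, U y -> J1 y = - (J3 y *m J2 y).
Hypothesis J312 : forall y, U y -> J3 y = J1 y *m J2 y.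
Hypothesis J321 : forall y, U y -> J3 y = - (J2 y *m J1 y).
Hypothesis J1_sqr : forall y, U y -> J1 y *m J1 y = - 1%:M.
Hypothesis J2_sqr : forall y, U y -> J2 y *m J2 y = - 1%:M.
Hypothesis J1_adj : forall y, U y -> (J1 y)^T *m g y = -1 *: (g y *m J1 y).
Hypothesis J2_adj : forall y, U y -> (J2 y)^T *m g y = 1 *: (g y *m J2 y).
Hypothesis J3_adj : forall y, U y -> (J3 y)^T *m g y = 1 *: (g y *m J3 y).
Hypothesis dJ1 : forall y w, U y -> 'D_w J1 y = J1 y *m A w y - A w y *m J1 y
  + (covec (om3 y) w *: J2 y - covec (om2 y) w *: J3 y).
Hypothesis dJ2 : forall y w, U y -> 'D_w J2 y = J2 y *m A w y - A w y *m J2 y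
  + (covec (om1 y) w *: J3 y - covec (om3 y) w *: J1 y).
Hypothesis dJ3 : forall y w, U y -> 'D_w J3 y = J3 y *m A w y - A w y *m J3 y
  + (covec (om2 y) w *: J1 y - covec (om1 y) w *: J2 y).

Lemma symmetric_skew0 y (S : 'M[R]_d) : U y ->
  S^T *m g y = 1 *: (g y *m S) -> S^T *m g y = -1 *: (g y *m S) -> S = 0.
Proof.
move=> Uy ->; rewrite scale1r scaleN1r => h; rewrite -(mulKmx (g_unit Uy) S).
have -> : g y *m S = 0; last by rewrite mulmx0.
apply/matrixP => i j; move/matrixP/(_ i j): h; rewrite oppmxE => h.
by rewrite [RHS]mxE; lra.
Qed.

Lemma adjoint_combination y (a b s : R) (S T : 'M[R]_d) :
  S^T *m g y = s *: (g y *m S) -> T^T *m g y = s *: (g y *m T) ->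
  (a *: S + b *: T)^T *m g y = s *: (g y *m (a *: S + b *: T)).
Proof.
move=> hS hT; rewrite linearD/= !linearZ/= mulmxDl mulmxDr scalerDr.
by rewrite -!scalemxAl -!scalemxAr hS hT !scalerA (mulrC a) (mulrC b).
Qed.

(** As J1 is g-skew, so is its covariant derivative; but this is a combination of
    the g-symmetric J2 and J3. *)
Lemma nabla_J1 y w : U y -> 'D_w J1 y = J1 y *m A w y - A w y *m J1 y.
Proof.
move=> Uy; pose S z := covec (om3 z) w *: J2 z + - covec (om2 z) w *: J3 z.
have dS : 'D_w J1 y = J1 y *m A w y - A w y *m J1 y + S y.
  by rewrite dJ1// /S scaleNr.
have hS := parallel_symmetry U_open g_smooth J1_smooth metric J1_adj Uy dS.
rewrite dS (symmetric_skew0 Uy _ hS) ?addr0//.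
exact: adjoint_combination (J2_adj Uy) (J3_adj Uy).
Qed.

(** The covariant derivative of a g-symmetric J is g-symmetric, which the
    J1-component, being g-skew, can only be by vanishing. *)
Lemma nabla_J1_component (J K : 'cV[R]_d -> 'M[R]_d) (b c : 'cV[R]_d -> R) y w :
  smooth_on U J ->
  (forall y, U y -> (J y)^T *m g y = 1 *: (g y *m J y)) ->
  (forall y, U y -> (K y)^T *m g y = 1 *: (g y *m K y)) ->
  'D_w J y = J y *m A w y - A w y *m J y + (b y *: K y + c y *: J1 y) ->
  U y -> c y *: J1 y = 0.
Proof.
move=> sJ Jadj Kadj dJ Uy.
have hS := parallel_symmetry (S := fun y => b y *: K y + c y *: J1 y)
  U_open g_smooth sJ metric Jadj Uy dJ.
apply: (symmetric_skew0 Uy).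
  have hK := adjoint_combination (b y) 0 (Kadj y Uy) (Kadj y Uy).
  have := adjoint_combination 1 (-1) hS hK.
  by rewrite scale0r addr0 scale1r scaleN1r addrAC subrr add0r.
have := adjoint_combination (c y) 0 (J1_adj Uy) (J1_adj Uy).
by rewrite scale0r addr0.
Qed.

Lemma nabla_J2 y w : U y ->
  'D_w J2 y = J2 y *m A w y - A w y *m J2 y + covec (om1 y) w *: J3 y.
Proof.
move=> Uy; have := @nabla_J1_component J2 J3 (fun z => covec (om1 z) w)
  (fun z => - covec (om3 z) w) y w J2_smooth J2_adj J3_adj.
by rewrite scaleNr dJ2// => /(_ erefl Uy) ->; rewrite addr0.
Qed.

Lemma nabla_J3 y w : U y ->
  'D_w J3 y = J3 y *m A w y - A w y *m J3 y - covec (om1 y) w *: J2 y.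
Proof.
move=> Uy; have := @nabla_J1_component J3 J2 (fun z => - covec (om1 z) w)
  (fun z => covec (om2 z) w) y w J3_smooth J3_adj J2_adj.
by rewrite scaleNr dJ3// [- _ + _]addrC => /(_ erefl Uy) ->; rewrite add0r.
Qed.

Lemma ricci_flat_curv0 x : U x ->
  (forall v z, \sum_(a < d) (curv A x (delta_mx a 0) v *m z) a (0 : 'I_1) = 0) ->
  forall u v, curv A x u v = 0.
Proof.
move=> Ux ric.
have alt := curv_alt Gam x.
have skew u v := curv_skew U_open Gam_smooth u v g_smooth metric Ux.
have bian u v w := curv_bianchi U_open Gam_smooth u v w torsion_free Ux.
have F1 u v : curv A x u v *m J1 x = J1 x *m curv A x u v.
  exact: (curv_commute U_open Gam_smooth _ _ J1_smooth nabla_J1 Ux).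
have F2 u v := curv_commutator U_open Gam_smooth u v J2_smooth J3_smooth
  om1_smooth nabla_J2 nabla_J3 Ux.
have J1_skew : (J1 x)^T *m g x = - (g x *m J1 x) by rewrite J1_adj// scaleN1r.
have J2_sym : (J2 x)^T *m g x = g x *m J2 x by rewrite J2_adj// scale1r.
have J3_sym : (J3 x)^T *m g x = g x *m J3 x by rewrite J3_adj// scale1r.
have tr0 := ricci_form_trace (g_unit Ux) (g_sym Ux) J1_skew alt skew bian F1 ric.
have F2' u v : curv A x u v *m J2 x = J2 x *m curv A x u v.
  have := traceless_commutator (J123 Ux) (J132 Ux) (J312 Ux) (J321 Ux)
    (J1_sqr Ux) (J2_sqr Ux) (F1 u v) (F2 u v) (tr0 u v).
  by rewrite -F2 => /eqP; rewrite subr_eq0 => /eqP.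
have F3 u v : curv A x u v *m J3 x = J3 x *m curv A x u v.
  by rewrite J312// mulmxA F1 -!mulmxA F2'.
exact: hyperkahler_NH_flat (g_unit Ux) (g_sym Ux) (J123 Ux) (J132 Ux)
  (J1_sqr Ux) J2_sym J3_sym alt skew bian F2' F3.
Qed.

End QuaternionKahlerChart.

(** * Charts of a manifold *)

Section Charts.
Context {R : realType} {d : nat} {M : topologicalType} (c : chart R d M).

Lemma in_coordS (W W' : set M) : W `<=` W' -> in_coord c W `<=` in_coord c W'.
Proof. by move=> WW' _ [p [cp Wp] <-]; exists p => //; split => //; exact: WW'. Qed.

Lemma in_coord_meet (W W' : set M) x :
  in_coord c W x -> W' (cinv c x) -> in_coord c W' x.
Proof. by move=> [p [cp Wp] <-]; rewrite cmapK// => W'p; exists p. Qed.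

(** Inside the open image of the chart, [in_coord c W] is the preimage of W under
    the continuous [cinv c]. *)
Lemma in_coord_open (W : set M) : open W -> open (in_coord c W).
Proof.
move=> oW; have := @cinv_continuous _ _ _ c.
rewrite (continuous_open_subspace _ (@cimg_open _ _ _ c)) => cc.
rewrite openE => _ [p [cp Wp] <-]; rewrite /interior.
have Ip : (cmap c @` cdom c) (cmap c p) by exists p.
have := cc (cmap c p) (mem_set Ip) W; rewrite /= cmapK// => h.
have nW : nbhs (cmap c p) (cinv c @^-1` W) by apply: h; exact: open_nbhs_nbhs.
have nI : nbhs (cmap c p) (cmap c @` cdom c).
  by apply: open_nbhs_nbhs; split => //; exact: cimg_open.
apply: filterS (filterI nI nW) => _ [[q cq <-] /=]; rewrite cmapK// => Wq.
by exists q.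
Qed.

End Charts.

Section LeviCivitaChart.
Context {R : realType} {d : nat} {M : smoothManifold R d}.
Variables (g : bilinear_field M) (nabla : affine_connection M).
Hypothesis hLC : levi_civita g nabla.
Variable i : atlas_index M.
Local Notation A := (conn (christoffel nabla i)).

Lemma coord_open : open (coord i).
Proof. exact/in_coord_open/openT. Qed.

Lemma cov_cst u v y : cov nabla i (fun=> u) (fun=> v) y = A u y *m v.
Proof. by rewrite /cov coord_covE (derive_cst v) add0r. Qed.

Lemma levi_civita_torsion_free y u v : coord i y -> A u y *m v = A v y *m u.
Proof.
move=> Uy; have [tf _] := hLC.
have := tf i _ _ (smooth_cst _ u) (smooth_cst _ v) y Uy.
rewrite !cov_cst /lie_bracket (derive_cst u) (derive_cst v) subrr.
by move/eqP; rewrite subr_eq0 => /eqP.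
Qed.

Lemma levi_civita_metric y w : coord i y ->
  'D_w (g i) y = (A w y)^T *m g i y + g i y *m A w y.
Proof.
move=> Uy; have [_ mt] := hLC; apply: bilinear_form_inj => a b.
have := mt i _ _ _ (smooth_cst _ w) (smooth_cst _ a) (smooth_cst _ b) y Uy.
rewrite !cov_cst /bil mulmxDr mulmxDl addmxE trmx_mul !mulmxA => <-.
have dg := smooth_is_derive w (bform_smooth g i) Uy.
have := is_derive_mulmx (is_derive_mulmx (is_derive_cst a^T y w) dg)
  (is_derive_cst b y w).
by rewrite !mul0mx !mulmx0 add0r addr0 => /is_derive_mxP/(_ 0 0)[_ ->].
Qed.

End LeviCivitaChart.

Lemma col_action_inj (R : pzRingType) m n (P Q : 'M[R]_(m, n)) :
  (forall z : 'cV[R]_n, P *m z = Q *m z) -> P = Q.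
Proof.
move=> PQ; apply/matrixP => i j.
by have /matrixP/(_ i 0) := PQ (delta_mx j 0); rewrite -!colE !mxE.
Qed.

Lemma bil_sym_mx (R : realType) d (G : 'M[R]_d) :
  (forall u v, bil G u v = bil G v u) -> G^T = G.
Proof.
move=> sG; apply: bilinear_form_inj => z w.
rewrite -/(bil G z w) sG /bil.
have -> (P : 'M[R]_1) : P 0 0 = P^T 0 0 by rewrite mxE.
by rewrite !trmx_mul !trmxK mulmxA.
Qed.

Lemma bil_compat_adjoint (R : realType) d (G J : 'M[R]_d) (e : R) :
  e * e = 1 -> J *m J = - 1%:M ->
  (forall u v, bil G u v = e * bil G (J *m u) (J *m v)) ->
  J^T *m G = - e *: (G *m J).
Proof.
move=> ee JJ h.
have -> : G *m J = - e *: (J^T *m G).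
  have {1}-> : G = e *: (J^T *m G *m J).
    apply: bilinear_form_inj => z w; rewrite -/(bil G z w) h /bil.
    by rewrite -scalemxAr -scalemxAl [RHS]mxE trmx_mul !mulmxA.
  by rewrite -scalemxAl -mulmxA JJ mulmxN mulmx1 scalerN scaleNr.
by rewrite scalerA mulrNN ee scale1r.
Qed.

Lemma signature_unit (R : realType) d p (G : 'M[R]_d) :
  signature p G -> G \in unitmx.
Proof.
move=> [P Pu PGP].
have : P^T *m G *m P \in unitmx.
  rewrite PGP unitmxE det_diag unitfE; apply/prodf_neq0 => k _.
  by rewrite mxE; case: ifP => _; rewrite ?oppr_eq0 oner_neq0.
by rewrite !unitmx_mul => /andP[/andP[]].
Qed.

(** Contracting with the inverse of g and pairing with g cancel, so that the Ricci
    tensor is the trace of u |-> F(u,v)z. *)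
Lemma ricci_cst (R : realType) d (M : smoothManifold R d)
    (g : bilinear_field M) (nabla : affine_connection M) i x v z :
  coord i x -> (g i x)^T = g i x -> g i x \in unitmx ->
  ricci g nabla i (fun=> v) (fun=> z) x =
  \sum_(a < d) (curv (conn (christoffel nabla i)) x (delta_mx a 0) v *m z) a 0.
Proof.
move=> Ux gs gu; apply: eq_bigr => a _.
set c := curv _ _ _ _ *m z.
rewrite -[c in RHS](mulKmx gu) mxE; apply: eq_bigr => b _; congr (_ * _).
rewrite /curvature4 /curvature (curvatureE (@coord_open _ _ M i)
  (christoffel_smooth nabla i) (smooth_cst _ _) (smooth_cst _ _)
  (smooth_cst _ _) Ux).
by rewrite -/c /bil /coord_field -colE mxE -{1}gs -trmx_mul mxE.
Qed.

Theorem proposition2p6 (R : realType) (n : nat)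
    (M : smoothManifold R (4 * n)%N) (H : almost_hypercomplex M)
    (G : NH_metric H) (nabla : affine_connection M)
    (hLC : levi_civita (nh_g G) nabla)
    (hQK : quaternionic_kahler H nabla) :
  ricci_flat (nh_g G) nabla <-> flat nabla.
Proof.
split; last first.
  move=> fl i Y Z sY sZ x Ux; rewrite /ricci big1// => a _; rewrite big1// => b _.
  rewrite /curvature4 fl//; last exact: smooth_cst.
  by rewrite /bil trmx0 !mul0mx mxE mulr0.
move=> rf i X Y Z sX sY sZ x Ux.
rewrite /curvature /cov (curvatureE (@coord_open _ _ M i)
  (christoffel_smooth nabla i) sX sY sZ Ux).
have [W [oW Wp [om qk]]] := hQK (cinv (atlas i) x).
set U := in_coord (atlas i) W.
have UU : U `<=` coord i by apply: in_coordS.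
have U'x : U x := in_coord_meet Ux Wp.
have cst_smooth (v : 'cV[R]_(4 * n)) : smooth_on U (fun=> v) by exact: smooth_cst.
pose a := ord0 : 'I_3; pose b := ordS a; pose c := ordS b.
have ca : ordS c = a by exact: val_inj.
have Jsm e : smooth_on U (H e i) := smooth_onS UU (endo_smooth (H e) i).
have dJ e y w : U y -> 'D_w (H e i) y =
   H e i y *m conn (christoffel nabla i) w y
   - conn (christoffel nabla i) w y *m H e i y
   + (covec (om (ordS (ordS e)) i y) w *: H (ordS e) i y
      - covec (om (ordS e) i y) w *: H (ordS (ordS e)) i y).
  (* The structure equation, evaluated on constant fields, is an identity of
     matrices. *)
  move=> Uy; apply/col_action_inj => z.
  have := qk e i _ _ (cst_smooth w) (cst_smooth z) y Uy.
  rewrite /cov_endo cov_cst /cov coord_covE => E.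
  have [_ dJz] :=
    is_derive_mulmx (smooth_is_derive w (Jsm e) Uy) (is_derive_cst z y w).
  rewrite dJz mulmx0 addr0 in E.
  rewrite !mulmxDl !mulNmx -!scalemxAl -E -!mulmxA.
  by rewrite [RHS]addrC addrA subrK addrK.
suff -> : curv (conn (christoffel nabla i)) x (X x) (Y x) = 0 by rewrite mul0mx.
have adj e y : U y -> (H e i y)^T *m G i y = - eps e *: (G i y *m H e i y).
  move=> /UU Uy; apply: bil_compat_adjoint.
  - by rewrite /eps; case: ifP => _; rewrite ?mulrNN mulr1.
  - exact: ahJ_sqr.
  - by move=> u v; exact: nh_compat.
have gu y : coord i y -> G i y \in unitmx.
  by move=> Uy; exact: signature_unit (nh_neutral G Uy).
have gs y : coord i y -> (G i y)^T = G i y.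
  by move=> Uy; exact: bil_sym_mx (nh_sym G Uy).
(* J1, J2, J3 are the structures of index a, b, c, which [ordS] permutes
   cyclically. *)
apply: (@ricci_flat_curv0 R (4 * n) U _ (G i) (H a i) (H b i) (H c i)
  (om a i) (om b i) (om c i)).
- exact: in_coord_open.
- by move=> k; exact: smooth_onS UU (christoffel_smooth nabla i k).
- exact: smooth_onS UU (bform_smooth (nh_g G) i).
- exact: Jsm.
- exact: Jsm.
- exact: Jsm.
- exact: oform_smooth.
- by move=> y u v /UU; exact: (levi_civita_torsion_free hLC).
- by move=> y w /UU; exact: (levi_civita_metric hLC).
- by move=> y /UU; exact: gu.
- by move=> y /UU; exact: gs.
- by move=> y /UU; exact: (ahJ_mul H a).
- by move=> y /UU; exact: (ahJ_anti H a).
- by move=> y /UU /(ahJ_mul H c); rewrite ca.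
- by move=> y /UU /(ahJ_anti H c); rewrite ca.
- by move=> y /UU; exact: (ahJ_sqr H a).
- by move=> y /UU; exact: (ahJ_sqr H b).
- by move=> y /adj ->.
- by move=> y /adj ->; rewrite /eps /= opprK.
- by move=> y /adj ->; rewrite /eps /= opprK.
- by move=> y w Uy; exact: (dJ a).
- by move=> y w Uy; rewrite (dJ b)// ca.
- by move=> y w Uy; rewrite (dJ c)// ca.
- exact: U'x.
- move=> v z; rewrite -(ricci_cst _ _ _ Ux (gs x Ux) (gu x Ux)).
  by apply: rf => //; exact: smooth_cst.
Qed.
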